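(* Let $\tau$ and $\sigma$ be types and $\delta=(d_1^{r_1}, \ldots, d_s^{r_s})$ be a sequence of blocks. Then the coefficient of $m^\otimes_\tau$ in the $m^\otimes$-expansion of $m^\otimes_\sigma H_\delta$ is $|\mathrm{HTBT}(\tau,(\sigma;\delta))|$, the number of $H$-tensor brick tabloids of shape $\tau$ and extended content $(\sigma;\delta)$.
   Context: An integer partition is a finite (possibly empty) weakly decreasing sequence of positive integers; $\ell(\lambda)$ is its number of parts and $m_k(\lambda)$ the number of parts equal to $k$. A block is an ordered pair of positive integers written $d^m$ (degree $d$, multiplicity $m$). Blocks are ordered by $a^b\ge d^e$ iff $a>d$, or $a=d$ and $b\ge e$. A type is a finite (possibly empty) weakly decreasing sequence of blocks. For $k\ge1$, $\tau|_k$ denotes the integer partition formed by the multiplicities of the blocks of $\tau$ of degree $k$; the type $\tau$ is determined by $(\tau|_k)_{k\ge1}$. The tensor diagram of $\tau$ is the sequence of partition diagrams $\mathrm{dg}(\tau|_1)\otimes\mathrm{dg}(\tau|_2)\otimes\cdots$; the $k$th component has left-justified rows of boxes of lengths the parts of $\tau|_k$. Variables: $x_{k,j}$ for $k,j\ge 1$, with $\deg x_{k,j}=k$; $\mathbf{x}_{k*}=(x_{k,1},x_{k,2},\dots)$. The algebra $\mathsf{P\Lambda}$ of polysymmetric functions consists of the formal series over $\mathbb{Q}$ of bounded degree in all the $x_{k,j}$ that, for each fixed $k$, are unchanged by any permutation of the variables $\mathbf{x}_{k*}$. Define $m^{\otimes}_\tau=\prod_{k\ge1}m_{\tau|_k}(\mathbf{x}_{k*})$,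 where $m_\lambda$ is the monomial symmetric function; as $\tau$ ranges over all types these form a basis of $\mathsf{P\Lambda}$. $H_d$ is the sum of all distinct monomials of degree $d$ in the variables $x_{k,j}$ (with $\deg x_{k,j}=k$), $H_{d^r}$ is obtained from $H_d$ by replacing every variable $x_{k,j}$ by $x_{k,j}^r$, and $H_\delta=\prod_{i=1}^sH_{d_i^{r_i}}$. An $H$-tensor brick tabloid (HTBT) of shape $\tau$ and extended content $(\sigma;\delta)$ is a covering of the tensor diagram of $\tau$ by labeled horizontal bricks (height $1$, each lying within a single row of a component, every box covered by exactly one brick) built as follows. Choose partitions $\lambda^{(i)}$ of $d_i$ for $i=1,\dots,s$. For each $k\ge1$, the $k$th component $\mathrm{dg}(\tau|_k)$ is covered using exactly: $m_k(\lambda^{(i)})$ bricks labeled $i$, each of length $r_i$, for each $i=1,\dots,s$; and $\ell(\sigma|_k)$ bricks labeled $0$ with lengths given by the parts of $\sigma|_k$. The labels must weakly increase from left to right in each row, and each row has at most one brick labeled $0$. Bricks with the same label and length are indistinguishable. *)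

(* Defs.v *)
From HB Require Import structures.
From mathcomp Require Import all_boot all_order all_algebra finmap.
From mathcomp Require Import boolp classical_sets functions cardinality fsbigop.
From mathcomp Require Import monalg.

Set Implicit Arguments.
Unset Strict Implicit.
Unset Printing Implicit Defensive.

Import Order.TTheory GRing.Theory Num.Theory.

Local Open Scope classical_set_scope.
Local Open Scope ring_scope.

Definition posnat := {n : nat | (0 < n)%N}.

Definition is_intpart (l : seq nat) : bool := sorted geq l && (0%N \notin l).

Definition is_intpart_of (d : nat) (l : seq nat) : bool :=
  is_intpart l && (sumn l == d).

(* The pair (d, m) is the block d^m. *)
Definition block := (posnat * posnat)%type.
Definition bdeg (b : block) : nat := val b.1.
Definition bmult (b : block) : nat := val b.2.

Definition block_ge : rel block := fun b c =>
  (bdeg c < bdeg b)%N || (bdeg b == bdeg c) && (bmult c <= bmult b)%N.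

(* Types are called btype, "type" being too generic. *)
Definition btype := {t : seq block | sorted block_ge t}.

(* tau|_k; the order on blocks makes it weakly decreasing, see
   [restrict_intpart]. *)
Definition restrict (tau : btype) (k : nat) : seq nat :=
  [seq bmult b | b <- val tau & bdeg b == k].

Lemma block_ge_trans : transitive block_ge.
Proof.
move=> y x z; rewrite /block_ge => /orP[xy|/andP[/eqP xy mxy]];
  move=> /orP[yz|/andP[/eqP yz myz]]; apply/orP.
- by left; exact: ltn_trans yz xy.
- by left; rewrite -yz.
- by left; rewrite xy.
- by right; rewrite xy yz eqxx /= (leq_trans myz).
Qed.

Lemma restrict_intpart (tau : btype) (k : nat) : is_intpart (restrict tau k).
Proof.
rewrite /is_intpart /restrict; apply/andP; split; last first.
  by apply/mapP => -[b _ b0]; have := valP b.2; rewrite -[val _]/(bmult b) -b0.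
have := sorted_filter block_ge_trans (fun b => bdeg b == k) (valP tau).
have := filter_all (fun b => bdeg b == k) (val tau).
case: [seq b <- _ | _] => //= b s /andP[/eqP bk].
elim: s b bk => //= c s IHs b bk /andP[/eqP ck sk] /andP[bc cs].
by rewrite IHs // andbT; move: bc; rewrite /block_ge bk ck ltnn eqxx.
Qed.

(* The pair (k, j) is the variable x_{k,j}. *)
Definition var := (posnat * posnat)%type.

Definition monomial := {cmonom var}.

Definition mwdeg (m : monomial) : nat :=
  (\sum_(v <- finsupp m) val v.1 * m v)%N.

(* A formal series is the function giving its coefficients. *)
Definition series := monomial -> rat.

Definition series_one : series := fun m => (m == mone)%:R.

(* The sum ranges over the factorizations of m, which are finitely many, see
   [finite_factorizations]. *)
Definition series_mul (f g : series) : series := fun m =>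
  \sum_(p \in [set p : monomial * monomial | mmul p.1 p.2 = m]) f p.1 * g p.2.

(* Replacement of every variable x by x ^ r, with 0 < r: the monomial n becomes
   n ^ r, so the sum below has at most one term. *)
Definition series_subst_pow (r : nat) (f : series) : series := fun m =>
  \sum_(n \in [set n : monomial | forall v, m v = (r * n v)%N]) f n.

Lemma finite_factorizations (m : monomial) :
  finite_set [set p : monomial * monomial | mmul p.1 p.2 = m].
Proof.
pose B := (\sum_(v <- finsupp m) m v)%N.
pose F (e : {ffun finsupp m -> 'I_B.+1}) : monomial :=
  mkcmonom [fsfun v : finsupp m => nat_of_ord (e v) | 0%N].
have fact (n n' : monomial) : mmul n n' = m -> range F n.
  move=> nn'; have le v : (n v <= m v)%N by rewrite -nn' cmM leq_addr.
  exists [ffun v => inord (n (val v))] => //.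
  apply/eqP/cmP => v; rewrite /F cmE /=.
  have [vm|vm] := boolP (v \in finsupp m).
    have -> : v = val [` vm]%fset by [].
    rewrite fsfun_ffun insubT /= ffunE inordK ?ltnS //.
    apply: (leq_trans (le v)); rewrite /B (big_fsetD1 v) //=.
    exact: leq_addr.
  rewrite fsfun_ffun insubN //=; move: (le v).
  by move: vm; rewrite -cmE_eq0 => /eqP ->; rewrite leqn0 => /eqP ->.
apply: (@sub_finite_set _ _ (range F `*` range F)); last first.
  by apply: finite_setX; apply: finite_image; exact: finite_finset.
move=> [n n'] /= nn'; split=> /=; first exact: fact nn'.
by apply: (@fact n' n); rewrite mulmC.
Qed.

Definition bounded_degree (f : series) : Prop :=
  exists D : nat, forall m : monomial, (D < mwdeg m)%N -> f m = 0.

(* The monomial m' is the image of m under x_{k,j} |-> x_{k,s(j)}. *)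
Definition symmetric_in_each_degree (f : series) : Prop :=
  forall (k : posnat) (s : posnat -> posnat), bijective s ->
  forall m m' : monomial,
    (forall j, m' (k, s j) = m (k, j)) ->
    (forall i j, i != k -> m' (i, j) = m (i, j)) ->
    f m' = f m.

Definition polysymmetric (f : series) : Prop :=
  bounded_degree f /\ symmetric_in_each_degree f.

(* The monomial symmetric function m_l(x_{k*}): the sum of the distinct
   monomials in the x_{k,j}, j >= 1, whose nonzero exponents are the parts
   of l. *)
Definition msym (k : nat) (l : seq nat) : series := fun m =>
  (all (fun v : var => val v.1 == k) (finsupp m)
   && perm_eq [seq m v | v <- finsupp m] l)%:R.

(* The product over all k >= 1 stops at the largest degree of a block of tau:
   the remaining factors are m_{emptyset} = 1. *)
Definition mtensor (tau : btype) : series :=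
  \big[series_mul/series_one]_(1 <= k < (\max_(b <- val tau) bdeg b).+1)
     msym k (restrict tau k).

Definition Hdeg (d : nat) : series := fun m => (mwdeg m == d)%:R.

Definition Hblock (b : block) : series :=
  series_subst_pow (bmult b) (Hdeg (bdeg b)).

Definition Hblocks (delta : seq block) : series :=
  \big[series_mul/series_one]_(b <- delta) Hblock b.

Definition mtensor_expansion (f : series) (c : {fsfun btype -> rat with 0}) :
    Prop :=
  forall m : monomial, f m = \sum_(tau <- finsupp c) c tau * mtensor tau m.

(* a is the coefficient of mtensor tau in the expansion of f; the existence
   and the uniqueness of the expansion are part of the assertion. *)
Definition is_mtensor_coef (tau : btype) (f : series) (a : rat) : Prop :=
  polysymmetric f /\
  exists c : {fsfun btype -> rat with 0},
    [/\ mtensor_expansion f c,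
        forall c', mtensor_expansion f c' -> c' = c
      & c tau = a].

(* (label, length) *)
Definition brick := (nat * nat)%type.

(* T k lists the rows of the k-th component of the tensor diagram, each of them
   being the sequence of its bricks from left to right: covering a row of n
   boxes by bricks amounts to listing bricks of total length n. Bricks carry
   no data besides label and length, which makes bricks with the same label
   and length indistinguishable. *)
Definition tabloid := nat -> seq (seq brick).

Definition row_length (row : seq brick) : nat := sumn [seq b.2 | b <- row].

Definition row_labels_ok (row : seq brick) : bool :=
  sorted leq [seq b.1 | b <- row] && (count (fun b => b.1 == 0%N) row <= 1)%N.

(* The multiset of the bricks of the k-th component. The i-th block of delta
   is at index i - 1, hence the labels i.+1. *)
Definition bricks (sigma : btype) (delta : seq block)
    (lam : 'I_(size delta) -> seq nat) (k : nat) : seq brick :=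
  [seq (0%N, l) | l <- restrict sigma k] ++
  flatten [seq nseq (count_mem k (lam i))
                    ((i : nat).+1, bmult (tnth (in_tuple delta) i))
          | i <- enum 'I_(size delta)].

(* For k = 0, which is not the index of a component, the conditions force
   T 0 = [::]. *)
Definition HTBT (tau sigma : btype) (delta : seq block) : set tabloid :=
  [set T | (forall k, [seq row_length row | row <- T k] = restrict tau k) /\
           (forall k, all row_labels_ok (T k)) /\
           exists lam : 'I_(size delta) -> seq nat,
             (forall i, is_intpart_of (bdeg (tnth (in_tuple delta) i)) (lam i))
             /\ forall k, perm_eq (flatten (T k)) (bricks sigma lam k)].

Lemma finite_bounded_seqs (T : eqType) (A : set T) (n : nat) : finite_set A ->
  finite_set [set s : seq T | (size s <= n)%N /\ forall x, x \in s -> A x].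
Proof.
move=> finA; elim: n => [|n IHn].
  apply: (@sub_finite_set _ _ [set [::]]); last exact: finite_set1.
  by move=> [|x s] [].
pose B := A `*` [set s : seq T | (size s <= n)%N /\ forall x, x \in s -> A x].
apply: (@sub_finite_set _ _ ([set [::]] `|` (fun p => p.1 :: p.2) @` B)).
  move=> [|x s] [ss sA]; [by left|right; exists (x, s) => //; split => /=].
    by apply: sA; rewrite mem_head.
  by split=> // y ys; apply: sA; rewrite in_cons ys orbT.
by rewrite finite_setU; split; [exact: finite_set1|
  apply: finite_image; exact: finite_setX].
Qed.

(* Hence the cardinal of [fset_set (HTBT tau sigma delta)] is the number of
   tabloids. *)
Lemma finite_HTBT (tau sigma : btype) (delta : seq block) :
  finite_set (HTBT tau sigma delta).
Proof.
pose M := (\max_(b <- val tau) bmult b)%N.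
pose K := (\max_(b <- val tau) bdeg b)%N.
pose A := [set b : brick | (b.1 < (size delta).+1)%N /\ (b.2 < M.+1)%N].
have finA : finite_set A.
  apply: (@sub_finite_set _ _ (`I_(size delta).+1 `*` `I_M.+1)) => //.
  by apply: finite_setX; exact: finite_II.
have finR := finite_bounded_seqs M finA.
have finC := finite_bounded_seqs (size (val tau)) finR.
have finT := finite_bounded_seqs K.+1 finC.
apply: (sub_finite_set _ (finite_image (fun s k => nth [::] s k) finT)).
move=> T [shT [_ [lam [_ conT]]]] /=.
exists (mkseq T K.+1); last first.
  apply/funext => k; have [kK|Kk] := ltnP k K.+1; first by rewrite nth_mkseq.
  rewrite nth_default ?size_mkseq //; apply/esym/size0nil.
  rewrite -(size_map row_length) shT size_map size_filter; apply/eqP.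
  rewrite -leqn0 leqNgt -has_count; apply/hasPn => b bt; apply/eqP => bk.
  by move: Kk; rewrite -bk ltnNge /K leq_bigmax_seq.
split=> [|_ /mapP[k _ ->]]; first by rewrite size_mkseq.
split=> [|row rowT].
  by rewrite -(size_map row_length) shT size_map size_filter count_size.
have rowM : (row_length row <= M)%N.
  have : row_length row \in restrict tau k by rewrite -shT map_f.
  move=> /mapP[b]; rewrite mem_filter => /andP[_ bt] ->.
  exact: leq_bigmax_seq.
have brickP b : b \in row -> (b.1 <= size delta)%N /\ (0 < b.2)%N.
  move=> brow; have : b \in bricks sigma lam k.
    by rewrite -(perm_mem (conT k)); apply/flattenP; exists row.
  rewrite mem_cat => /orP[/mapP[l ls ->] /=|].
    by split=> //; case/mapP: ls => -[d [m m0]] _ ->.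
  move=> /flattenP[_ /mapP[i _ ->]]; rewrite mem_nseq => /andP[_ /eqP ->] /=.
  by split=> //; case: (tnth _ _) => -[d d0] [m m0].
split=> [|b brow].
  apply: leq_trans rowM; rewrite /row_length.
  elim: row brickP {rowT} => //= b s IHs bP.
  rewrite -add1n leq_add ?IHs //; first by case: (bP b) => //; rewrite mem_head.
  by move=> c cs; apply: bP; rewrite in_cons cs orbT.
split; first by case: (brickP b brow).
rewrite ltnS; apply: leq_trans rowM; rewrite /row_length sumnE big_map.
by rewrite (big_rem b) //= leq_addr.
Qed.

(* Main.v *)
Require Import Defs.
From HB Require Import structures.
From mathcomp Require Import all_boot all_order all_algebra finmap.
From mathcomp Require Import boolp classical_sets functions cardinality fsbigop.
From mathcomp Require Import monalg.

(** The coefficient of a monomial m in m_sigma H_delta is the number of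
    factorizations m = n p_1^r_1 ... p_s^r_s in which n has type sigma and p_i
    is a monomial of degree d_i: indeed m_sigma is the sum of the monomials of
    type sigma ([mtensor_gen_series]), H_{d^r} is the sum of the p^r for p of
    degree d ([Hblock_gen_series]), and the product of two series that count
    objects counts the pairs of objects ([gen_series_mul]).

    Such a factorization is the same thing as a tabloid. The rows of the tensor
    diagram of the type of m correspond to the variables v of m, the length of
    a row being the exponent of v. This exponent is n(v) + sum_i r_i p_i(v): it
    is displayed by a brick of length n(v) labeled 0, when n(v) > 0, followed
    by p_i(v) bricks of length r_i labeled i, for each i in turn. Since labels
    increase along rows and label 0 occurs at most once in a row, the row
    conversely determines n(v) and all p_i(v) ([brick_row_decode]). The bricks
    labeled 0 in the k-th component have the parts of sigma|_k as lengths
    exactly when n has type sigma; the number of bricks labeled i there is the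
    exponent of degree k variables in p_i, so that these numbers are the
    multiplicities of a partition of deg p_i ([row_tabloid_content]). Hence the
    tabloids of content (sigma; delta) and shape the type of m are in bijection
    with the factorizations of m ([row_tabloid_bij]).

    In particular the coefficient of m depends only on the type of m. A series
    f m = g (type of m) that is homogeneous is polysymmetric, and as each
    monomial belongs to exactly one tensor monomial function, the one of its
    type ([mtensorE]), g gives the coefficients of its only expansion
    ([mtensor_coef_of_type]). *)

Set Implicit Arguments.
Unset Strict Implicit.
Unset Printing Implicit Defensive.

Import Order.TTheory GRing.Theory Num.Theory.
(* [restrict] is the restriction of a type, not that of a function. *)
Import Defs.

Local Open Scope classical_set_scope.
Local Open Scope ring_scope.

(** * Series that count objects by weight *)

(** The formal sum of the monomials w x, for x in A. It has its meaning only
    when A has [finite_fibres]: a sum with infinite support is 0 by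
    convention. *)
Definition gen_series (T : choiceType) (A : set T) (w : T -> monomial) :
    series :=
  fun m => \sum_(x \in A `&` w @^-1` [set m]) (1 : rat).

Definition finite_fibres (T U : Type) (A : set T) (w : T -> U) : Prop :=
  forall u, finite_set (A `&` w @^-1` [set u]).

Lemma inj_finite_fibres (T U : Type) (A : set T) (w : T -> U) :
  injective w -> finite_fibres A w.
Proof.
move=> inj u; apply: finite_setIr; apply: finite_preimage => //.
by move=> x y _ _; exact: inj.
Qed.

(** The sum over A is split along the fibres of w; exchanging the two sums
    shows that each x is counted once, in the fibre over w x. *)
Lemma fsbig_fibres (T U : choiceType) (A : set T) (D : set U) (w : T -> U)
    (F : T -> rat) :
  finite_set A -> finite_set D -> (forall x, A x -> D (w x)) ->
  \sum_(x \in A) F x = \sum_(u \in D) \sum_(x \in A `&` w @^-1` [set u]) F x.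
Proof.
move=> finA finD AD.
under [RHS]eq_fsbigr => u _ do rewrite fsbig_mkcondr.
rewrite exchange_fsbig //; apply: eq_fsbigr => x /set_mem Ax.
rewrite (fsbigD1 (w x)) //=; last exact: AD.
rewrite mem_set // fsbig1 ?addr0 // => u [_ /= uwx].
by rewrite memNset //= => wxu; apply: uwx.
Qed.

(** A monomial has finitely many factorizations, and over each of them lies
    a product of two finite fibres. *)
Lemma finite_fibres_mul (T U : choiceType) (A : set T) (B : set U) w v :
  finite_fibres A w -> finite_fibres B v ->
  finite_fibres (A `*` B) (fun p => mmul (w p.1) (v p.2) : monomial).
Proof.
move=> finA finB m.
apply: (@sub_finite_set _ _ (\bigcup_(q in
   [set q : monomial * monomial | mmul q.1 q.2 = m])
     ((A `&` w @^-1` [set q.1]) `*` (B `&` v @^-1` [set q.2])))).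
  by move=> [x y] /= [[/= Ax By] wm]; exists (w x, v y).
by apply: bigcup_finite; [exact: finite_factorizations|
  move=> q _; exact: finite_setX].
Qed.

(** A pair (x, y) of weight m is a factorization m = n n' together with x of
    weight n and y of weight n': distributivity in the definition of the
    product, read backwards. *)
Lemma gen_series_mul (T U : choiceType) (A : set T) (B : set U) w v :
  finite_fibres A w -> finite_fibres B v ->
  series_mul (gen_series A w) (gen_series B v) =
  gen_series (A `*` B) (fun p => mmul (w p.1) (v p.2)).
Proof.
move=> finA finB; apply/funext => m; rewrite /series_mul /gen_series.
rewrite [RHS](@fsbig_fibres _ _ _ [set q : monomial * monomial |
    mmul q.1 q.2 = m] (fun p => (w p.1, v p.2))); first last.
- by move=> [x y] [].
- exact: finite_factorizations.
- exact: finite_fibres_mul.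
apply: eq_fsbigr => -[n n'] /set_mem /= nn'.
rewrite mulr_fsuml; under eq_fsbigr do rewrite mul1r.
rewrite pair_fsbig //; apply: eq_fsbigl; apply/seteqP; split=> -[x y] /=.
  by move=> [[Ax wx] [By vy]]; rewrite /preimage /= wx vy.
by move=> [[[Ax By] _] [wx vy]].
Qed.

(** The tool that replaces the pairs made by [gen_series_mul] with a more
    convenient set of objects. *)
Lemma gen_series_bij (T U : choiceType) (A : set T) (B : set U) w v h :
  set_bij A B h -> (forall x, A x -> v (h x) = w x) ->
  gen_series A w = gen_series B v.
Proof.
move=> [AB hinj hsurj] vh; apply/funext => m.
rewrite /gen_series; apply/esym; apply: (reindex_fsbig h); split.
- by move=> x [Ax wx]; split=> /=; [exact: AB|rewrite vh].
- move=> x y /set_mem [Ax _] /set_mem [Ay _].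
  by apply: hinj; rewrite inE.
move=> y [/hsurj [x Ax <-] vy]; exists x => //; split=> //=.
by rewrite -vh.
Qed.

Lemma gen_series_card (T : choiceType) (A : set T) w m :
  finite_fibres A w ->
  gen_series A w m = (#|` fset_set (A `&` w @^-1` [set m])|)%fset%:R.
Proof.
move=> finA; rewrite /gen_series fsbig_finite //.
by rewrite big_const_seq count_predT iter_addr_0.
Qed.

Lemma indicator_gen_series (A : set monomial) (P : pred monomial) :
  (forall m, P m <-> A m) -> (fun m => (P m)%:R) = gen_series A id.
Proof.
move=> PA; apply/funext => m; rewrite /gen_series.
have [Pm|Pm] := boolP (P m).
  rewrite (_ : _ `&` _ = [set m]) ?fsbig_set1 //.
  by apply/seteqP; split=> n /= => [[]|->] //; split=> //; apply/PA.
rewrite (_ : _ `&` _ = set0) ?fsbig_set0 //.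
apply/seteqP; split=> n //= [/PA Pn nm].
by move: Pm; rewrite -nm Pn.
Qed.

(** * Monomials and their types *)

Definition posone : posnat := exist _ 1%N isT.

Definition pow_mon (r : nat) (n : monomial) : monomial :=
  mkcmonom [fsfun v in finsupp n => (r * n v)%N | 0%N].

Lemma pow_monE r n v : pow_mon r n v = (r * n v)%N.
Proof. by rewrite cmE fsfun_fun; case: mdomP => //; rewrite muln0. Qed.

Definition restr_mon (p : pred var) (n : monomial) : monomial :=
  mkcmonom [fsfun v in finsupp n => if p v then n v else 0%N | 0%N].

Lemma restr_monE p n v : restr_mon p n v = if p v then n v else 0%N.
Proof. by rewrite cmE fsfun_fun; case: mdomP => //; rewrite if_same. Qed.

(** Sums over the supports of different monomials are compared by extending
    both to the support of the product of these monomials. *)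
Lemma big_finsupp_widen (R : Type) (idx : R) (op : Monoid.com_law idx)
    (m n : monomial) (P : pred var) (F : var -> R) :
  (forall v, m v = 0%N -> F v = idx) -> (forall v, n v = 0%N -> F v = idx) ->
  \big[op/idx]_(v <- finsupp m | P v) F v =
  \big[op/idx]_(v <- finsupp n | P v) F v.
Proof.
have sub (k l : monomial) : (finsupp k `<=` finsupp l)%fset ->
    (forall v, k v = 0%N -> F v = idx) ->
    \big[op/idx]_(v <- finsupp k | P v) F v =
    \big[op/idx]_(v <- finsupp l | P v) F v.
  move=> kl k0; rewrite big_mkcond [RHS]big_mkcond /=.
  apply: big_fset_incl => // v _ vk; case: ifP => // _.
  by apply: k0; apply/eqP; rewrite cmE_eq0.
move=> m0 n0; rewrite (sub m (mmul m n)) 1?(sub n (mmul m n)) // mdomD.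
- exact: fsubsetUr.
- exact: fsubsetUl.
Qed.

(** The degree k part of the type of m, in the arbitrary order of the
    support: it is used only up to permutation. *)
Definition mon_part (m : monomial) (k : nat) : seq nat :=
  [seq m v | v <- finsupp m & val v.1 == k].

Lemma count_mon_part (a : pred nat) (m : monomial) (k : nat) :
  count a (mon_part m k) = (\sum_(v <- finsupp m | val v.1 == k) a (m v))%N.
Proof.
rewrite /mon_part -sum1_count big_map big_filter_cond big_mkcondr /=.
by apply: eq_bigr => v _; case: (a _).
Qed.

Lemma mon_part_local (m n : monomial) (k : nat) :
  (forall v, val v.1 = k -> m v = n v) -> perm_eq (mon_part m k) (mon_part n k).
Proof.
move=> mn; rewrite /mon_part.
have -> : [seq m v | v <- finsupp m & val v.1 == k] =
          [seq n v | v <- finsupp m & val v.1 == k].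
  by apply/eq_in_map => v; rewrite mem_filter => /andP[/eqP /mn ->].
apply: perm_map; apply: uniq_perm; rewrite ?filter_uniq ?fset_uniq // => v.
rewrite !mem_filter; case: eqP => //= /mn vmn.
by rewrite -!cmE_neq0 vmn.
Qed.

Lemma mon_part_nil (m : monomial) (k : nat) :
  perm_eq (mon_part m k) [::] -> forall v, val v.1 = k -> m v = 0%N.
Proof.
move=> /perm_nilP pk v vk; apply/eqP; rewrite cmE_eq0; apply/negP => vm.
suff : m v \in mon_part m k by rewrite pk.
by apply/mapP; exists v => //; rewrite mem_filter vk eqxx.
Qed.

Lemma block_ge_anti : antisymmetric block_ge.
Proof.
move=> [d e] [d' e']; rewrite /block_ge /bdeg /bmult /= => h.
suff [dd ee] : val d = val d' /\ val e = val e'.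
  by congr (_, _); exact: val_inj.
case/andP: h => /orP[h1|/andP[/eqP h1 h2]] /orP[h3|/andP[/eqP h3 h4]].
- by move: (ltn_trans h1 h3); rewrite ltnn.
- by move: h1; rewrite h3 ltnn.
- by move: h3; rewrite h1 ltnn.
- by split=> //; apply/eqP; rewrite eqn_leq h2 h4.
Qed.

Lemma block_ge_total : total block_ge.
Proof.
move=> b c; rewrite /block_ge.
by case: (ltngtP (bdeg b) (bdeg c)) => //= _; rewrite leq_total.
Qed.

Lemma count_restrict (a : pred nat) (t : btype) (k : nat) :
  count a (restrict t k) =
  count (fun b => (bdeg b == k) && a (bmult b)) (val t).
Proof.
rewrite /restrict count_map count_filter; apply: eq_count => b /=.
by rewrite andbC.
Qed.

(** The multiplicity of the block d^e in a type is that of e among the parts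
    of its restriction to d, and a type is a sorted list of blocks. *)
Lemma btype_restrictP (t u : btype) :
  (forall k, perm_eq (restrict t k) (restrict u k)) -> t = u.
Proof.
move=> tu; apply: val_inj.
apply: (sorted_eq block_ge_trans block_ge_anti (valP t) (valP u)).
apply/allP => b _ /=; apply/eqP.
have := permP (tu (bdeg b)) (pred1 (bmult b)).
rewrite !count_restrict.
suff e : (fun c => (bdeg c == bdeg b) && pred1 (bmult b) (bmult c)) =1 pred1 b.
  by rewrite !(eq_count e).
case: b => d e [d' e'] /=; rewrite /bdeg /bmult /= !val_eqE.
by rewrite -pair_eqE.
Qed.

Definition var_block (m : monomial) (v : var) : block :=
  (v.1, insubd posone (m v)).

Lemma bmult_var_block (m : monomial) (v : var) :
  v \in finsupp m -> bmult (var_block m v) = m v.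
Proof. by rewrite -cmE_neq0 -lt0n => mv; rewrite /bmult /= insubdK. Qed.

(** The type whose tensor monomial function contains m: each variable
    x_{k,j} of m with exponent e gives the block k^e. *)
Definition mon_type (m : monomial) : btype :=
  exist _ (sort block_ge [seq var_block m v | v <- finsupp m])
    (sort_sorted block_ge_total _).

Lemma restrict_mon_type (m : monomial) (k : nat) :
  perm_eq (restrict (mon_type m) k) (mon_part m k).
Proof.
apply/permP => a; rewrite count_restrict /=.
rewrite (permP (permEl (perm_sort _ _))) count_map count_mon_part.
rewrite -sum1_count big_seq_cond [RHS]big_seq_cond -big_mkcondr /= /bdeg /=.
rewrite [RHS]big_mkcond [LHS]big_mkcond /=; apply: eq_bigr => v _.
by case vm: (v \in finsupp m) => //=; rewrite bmult_var_block.
Qed.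

Lemma mon_typeP (m : monomial) (t : btype) :
  (forall k, perm_eq (mon_part m k) (restrict t k)) <-> mon_type m = t.
Proof.
split=> [mt|<- k]; last by rewrite perm_sym restrict_mon_type.
apply: btype_restrictP => k; apply: perm_trans (mt k).
exact: restrict_mon_type.
Qed.

(** * The factors as counting series *)

(** The monomials occurring in the product of the functions m_{l k}(x_{k*})
    for k in s. *)
Definition mon_parts_on (s : seq nat) (l : nat -> seq nat) : set monomial :=
  [set m : monomial | (forall v, m v != 0%N -> val v.1 \in s) /\
           forall k, k \in s -> perm_eq (mon_part m k) (l k)].

Lemma msym_gen_series (k : nat) (l : nat -> seq nat) :
  msym k (l k) = gen_series (mon_parts_on [:: k] l) id.
Proof.
apply: indicator_gen_series => m.
have degk : all (fun v : var => val v.1 == k) (finsupp m) <->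
            forall v, m v != 0%N -> val v.1 \in [:: k].
  split=> [/allP mk v|mk]; first by rewrite cmE_neq0 inE => /mk.
  by apply/allP => v; rewrite -cmE_neq0 => /mk; rewrite inE.
have part : all (fun v : var => val v.1 == k) (finsupp m) ->
            mon_part m k = [seq m v | v <- finsupp m].
  by rewrite /mon_part => /all_filterP ->.
split=> [/andP[mk ml]|[/degk mk ml]].
  by split=> [|j]; [exact/degk|rewrite inE => /eqP ->; rewrite part].
by rewrite mk -part // ml ?mem_head.
Qed.

Lemma series_one_gen_series (T : choiceType) (x : T) :
  series_one = gen_series [set x] (fun=> mone).
Proof.
rewrite /series_one (@indicator_gen_series [set mone]) => [|m]; last first.
  by split=> [/eqP|/= ->].
apply: (@gen_series_bij _ _ _ _ _ _ (fun=> x)) => //.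
by split=> [?|? ? /set_mem /= -> /set_mem /= ->|? /= ->] //; exists mone.
Qed.

(** The functions multiplied involve disjoint sets of variables, so a
    monomial factors in only one way: into its parts of the various degrees.
    Hence all coefficients of the product are 0 or 1. *)
Lemma msym_prod_gen_series (s : seq nat) (l : nat -> seq nat) : uniq s ->
  \big[series_mul/series_one]_(k <- s) msym k (l k) =
  gen_series (mon_parts_on s l) id.
Proof.
have fin (A : set monomial) : finite_fibres A id by exact: inj_finite_fibres.
elim: s => [_|k s IHs /= /andP[ks us]].
  rewrite big_nil; apply: indicator_gen_series => m; split=> [/eqP ->|[m0 _]].
    by split=> // v; rewrite cm1.
  by apply/cmP => v; rewrite cm1; apply/eqP; apply: contraT => /m0.
rewrite big_cons IHs // msym_gen_series gen_series_mul //.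
apply: (@gen_series_bij _ _ _ _ _ _ (fun p => mmul p.1 p.2)) => //.
have zero1 (n : monomial) v : mon_parts_on [:: k] l n -> val v.1 != k ->
    n v = 0%N.
  by move=> [nk _]; apply: contraNeq => /nk; rewrite inE.
have zero2 (n : monomial) v : mon_parts_on s l n -> val v.1 = k -> n v = 0%N.
  by move=> [ns _] vk; apply: contraNeq ks => /ns; rewrite vk.
split.
- move=> [n n'] [/= nP n'P]; split=> [v|j].
    rewrite cmM inE; have [//|vk] := eqVneq (val v.1) k; rewrite /=.
    by rewrite (zero1 n) // add0n; exact: n'P.1.
  rewrite inE => /predU1P[->|js].
    apply: perm_trans (nP.2 k _); rewrite ?mem_head //.
    by apply: mon_part_local => v vk; rewrite cmM (zero2 n') // addn0.
  apply: perm_trans (n'P.2 j js); apply: mon_part_local => v vj.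
  rewrite cmM (zero1 n) // vj.
  by apply: contraNneq ks => <-.
- move=> [n n'] [p p'] /set_mem [/= nP n'P] /set_mem [/= pP p'P].
  move=> /eqP/cmP np; congr (_, _); apply/eqP/cmP => v; move: (np v);
    rewrite !cmM; have [vk|vk] := eqVneq (val v.1) k.
  + by rewrite (zero2 n') // (zero2 p') // !addn0.
  + by rewrite (zero1 n) // (zero1 p).
  + by rewrite (zero2 n') // (zero2 p').
  + by rewrite (zero1 n) // (zero1 p).
(* The only candidate splits m into the parts of degree k and not k. *)
- move=> m [ms ml].
  exists (restr_mon (fun v => val v.1 == k) m,
          restr_mon (fun v => val v.1 != k) m); last first.
    by apply/eqP/cmP => v; rewrite cmM !restr_monE; case: eqP; rewrite ?addn0.
  split=> /=; split=> [v|j].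
  + by rewrite restr_monE inE; case: ifP.
  + rewrite inE => /eqP ->; apply: perm_trans (ml k _); rewrite ?mem_head //.
    by apply: mon_part_local => v vk; rewrite restr_monE vk eqxx.
  + rewrite restr_monE; case: ifP => // vk /ms.
    by rewrite inE (negbTE vk).
  + move=> js; apply: perm_trans (ml j _); last by rewrite inE js orbT.
    apply: mon_part_local => v vj; rewrite restr_monE vj.
    by case: eqP => // jk; rewrite jk (negbTE ks) in js.
Qed.

Lemma mtensor_gen_series (t : btype) :
  mtensor t = gen_series [set m : monomial | mon_type m = t] id.
Proof.
rewrite /mtensor msym_prod_gen_series ?iota_uniq //; congr gen_series.
have out k : k \notin index_iota 1 (\max_(b <- val t) bdeg b).+1 ->
    restrict t k = [::].
  rewrite mem_index_iota ltnS negb_and -leqNgt leqn0 -ltnNge => kt.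
  apply/eqP; rewrite -size_eq0 size_map size_filter -leqn0 leqNgt -has_count.
  apply/hasPn => b bt; apply/eqP => bk; move: kt; rewrite -bk ltnNge.
  rewrite leq_bigmax_seq // orbF => /eqP b0.
  by have := valP b.1; rewrite /= -/(bdeg b) b0.
apply/seteqP; split=> m /= => [[ms mt]|/mon_typeP mt].
  apply/mon_typeP => k.
  have [kt|kt] := boolP (k \in index_iota 1 (\max_(b <- val t) bdeg b).+1).
    exact: mt.
  rewrite out //; case E: (mon_part m k) => [//|e u].
  have : e \in mon_part m k by rewrite E mem_head.
  move=> /mapP[v]; rewrite mem_filter -cmE_neq0 => /andP[/eqP vk /ms].
  by rewrite vk (negbTE kt).
split=> // v; apply: contraNT => /out vt.
by apply/eqP; apply: (@mon_part_nil m (val v.1)) => //; rewrite -vt.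
Qed.

(** The tensor monomial functions partition the monomials according to type;
    this is what makes the coefficient of an expansion readable on one
    monomial. *)
Lemma mtensorE (t : btype) (m : monomial) : mtensor t m = (mon_type m == t)%:R.
Proof.
rewrite mtensor_gen_series.
rewrite -(@indicator_gen_series _ (fun m => mon_type m == t)) //.
by move=> n; split=> /eqP.
Qed.

(** The product of the p_i ^ r_i, for which H_delta is the sum over all
    sequences of monomials p_i with deg p_i = d_i. *)
Definition pow_prod (rs : seq nat) (ps : seq monomial) : monomial :=
  \big[mmul/mone]_(x <- zip rs ps) pow_mon x.1 x.2.

Lemma pow_prodE rs ps v : size ps = size rs ->
  pow_prod rs ps v = (\sum_(i < size rs) nth 0%N rs i * nth mone ps i v)%N.
Proof.
rewrite /pow_prod; elim: rs ps => [|r rs IHrs] [|p ps] //=.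
  by rewrite big_nil cm1 big_ord0.
move=> [sz]; rewrite big_cons cmM pow_monE IHrs // big_ord_recl /=.
by [].
Qed.

Definition mons_of_degrees (ds : seq nat) : set (seq monomial) :=
  [set ps | map mwdeg ps = ds].

Lemma pow_mon_inj r : (0 < r)%N -> injective (pow_mon r).
Proof.
move=> r0 n n' /eqP/cmP nn'; apply/eqP/cmP => v; move: (nn' v).
by rewrite !pow_monE => /eqP; rewrite eqn_pmul2l // => /eqP.
Qed.

(** Raising variables to the power r is injective on monomials when r is
    positive, so every monomial n of degree d contributes the monomial n ^ r
    once. *)
Lemma Hblock_gen_series (b : block) :
  Hblock b = gen_series [set n | mwdeg n = bdeg b] (pow_mon (bmult b)).
Proof.
apply/funext => m; rewrite /Hblock /series_subst_pow /gen_series.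
have -> : [set n : monomial | forall v, m v = (bmult b * n v)%N] =
          pow_mon (bmult b) @^-1` [set m].
  apply/seteqP; split=> n /= => [mn|<- v]; last by rewrite pow_monE.
  by apply/eqP/cmP => v; rewrite pow_monE mn.
rewrite fsbig_mkcondl; apply: eq_fsbigr => n _; rewrite /Hdeg.
by case: eqP => nb; [rewrite mem_set|rewrite memNset].
Qed.

Lemma Hblocks_gen_series (delta : seq block) :
  finite_fibres (mons_of_degrees (map bdeg delta)) (pow_prod (map bmult delta))
  /\ Hblocks delta = gen_series (mons_of_degrees (map bdeg delta))
                       (pow_prod (map bmult delta)).
Proof.
elim: delta => [|b delta [IHfin IHgen]]; rewrite /Hblocks.
  have -> : mons_of_degrees (map bdeg [::]) = [set [::]].
    by apply/seteqP; split=> [[]|? ->].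
  split=> [m|]; first exact: finite_setIl.
  rewrite big_nil (series_one_gen_series ([::] : seq monomial)).
  congr gen_series; apply/funext => ps.
  by rewrite /pow_prod; case: ps => [|p ps]; rewrite big_nil.
have bij : set_bij ([set n | mwdeg n = bdeg b] `*`
      mons_of_degrees (map bdeg delta))
    (mons_of_degrees (map bdeg (b :: delta))) (fun p => p.1 :: p.2).
  split=> [[n ps] [/= nb psd]|[n ps] [n' ps'] _ _ /= [-> ->]|] //.
    by rewrite /mons_of_degrees /= nb psd.
  by move=> [|n ps] //= [nb psd]; exists (n, ps).
have pp n ps : pow_prod (map bmult (b :: delta)) (n :: ps) =
    mmul (pow_mon (bmult b) n) (pow_prod (map bmult delta) ps).
  by rewrite /pow_prod /= big_cons.
have finb : finite_fibres [set n | mwdeg n = bdeg b] (pow_mon (bmult b)).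
  by apply: inj_finite_fibres; apply: pow_mon_inj; exact: (valP b.2).
split.
  move=> m; have [_ _ surj] := bij.
  apply: sub_finite_set (finite_image (fun p => p.1 :: p.2)
    (finite_fibres_mul finb IHfin m)).
  by move=> _ [/surj [[n ps] ? <-] /= psm]; exists (n, ps) => //; rewrite -pp.
rewrite big_cons -/(Hblocks delta) IHgen Hblock_gen_series gen_series_mul //.
exact: gen_series_bij bij _.
Qed.

(** * Rows of bricks *)

(** The row attached to a variable: e0 is its exponent in the factor coming
    from m_sigma, drawn as one brick labeled 0 unless it is 0, and the i-th
    entry of es is its exponent in p_i, drawn as that many bricks of length
    r_i. Labels 0, 1, ..., s index the two lists e0 :: rs (lengths) and [0 <
    e0] :: es (numbers of bricks). *)
Definition brick_row (rs : seq nat) (e0 : nat) (es : seq nat) : seq brick :=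
  flatten [seq nseq (nth 0%N (nat_of_bool (0 < e0)%N :: es) l)
                    (l, nth 0%N (e0 :: rs) l) | l <- iota 0 (size rs).+1].

Lemma big_flatten_nseq (I T : Type) (s : seq I) (c : I -> nat) (x : I -> T)
    (F : T -> nat) :
  (\sum_(b <- flatten [seq nseq (c i) (x i) | i <- s]) F b =
   \sum_(i <- s) c i * F (x i))%N.
Proof.
elim: s => [|i s IHs]; first by rewrite !big_nil.
by rewrite /= big_cat IHs big_cons big_nseq iter_addn_0 mulnC.
Qed.

Lemma count_sum_bool (T : Type) (a : pred T) (s : seq T) :
  count a s = (\sum_(x <- s) a x)%N.
Proof.
by rewrite -sum1_count big_mkcond; apply: eq_bigr => x _; case: (a x).
Qed.

(** All statistics of a row that matter below, its length and the numbers of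
    its bricks of any kind, are instances of this formula. *)
Lemma sum_brick_row (rs es : seq nat) (e0 : nat) (F : brick -> nat) :
  (\sum_(b <- brick_row rs e0 es) F b =
   (0 < e0) * F (0, e0) +
   \sum_(i < size rs) nth 0 es i * F (i.+1, nth 0 rs i))%N.
Proof.
rewrite big_flatten_nseq -[iota 0 _]/(index_iota 0 (size rs).+1) big_mkord.
by rewrite big_ord_recl.
Qed.

Lemma row_length_brick_row rs e0 es :
  row_length (brick_row rs e0 es) =
  (e0 + \sum_(i < size rs) nth 0 es i * nth 0 rs i)%N.
Proof.
rewrite /row_length sumnE big_map sum_brick_row /=.
by case: e0 => [|e0]; rewrite ?mul1n.
Qed.

Lemma labels_brick_row rs e0 es :
  [seq b.1 | b <- brick_row rs e0 es] =
  flatten [seq nseq (nth 0%N (nat_of_bool (0 < e0)%N :: es) l) l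
          | l <- iota 0 (size rs).+1].
Proof.
rewrite /brick_row map_flatten -map_comp; congr flatten.
by apply: eq_map => l /=; rewrite map_nseq.
Qed.

Lemma count_label0_brick_row rs e0 es :
  count (fun b : brick => b.1 == 0%N) (brick_row rs e0 es) = (0 < e0)%N.
Proof.
rewrite count_sum_bool sum_brick_row /= big1 ?addn0 ?muln1 // => i _.
by rewrite muln0.
Qed.

Lemma sum_label0_brick_row rs e0 es :
  (\sum_(b <- brick_row rs e0 es | b.1 == 0) b.2)%N = e0.
Proof.
rewrite big_mkcond sum_brick_row /= big1 ?addn0 //.
  by case: e0 => // ?; rewrite mul1n.
by move=> i _; rewrite muln0.
Qed.

Lemma count_labelS_brick_row rs e0 es (i : nat) : (i < size rs)%N ->
  count (fun b : brick => b.1 == i.+1) (brick_row rs e0 es) = nth 0%N es i.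
Proof.
move=> irs; rewrite count_sum_bool sum_brick_row muln0 add0n.
rewrite (bigD1 (Ordinal irs)) //= eqxx muln1 big1 ?addn0 // => j /eqP ji.
by rewrite eqSS; case: eqP => [e|]; [case: ji; exact: val_inj|rewrite muln0].
Qed.

Lemma sorted_flatten_nseq (s : seq nat) (c : nat -> nat) :
  sorted leq s -> sorted leq (flatten [seq nseq (c l) l | l <- s]).
Proof.
rewrite !(sorted_pairwise leq_trans).
elim: s => //= l s IHs /andP[ls /IHs ps]; rewrite pairwise_cat ps andbT.
apply/andP; split.
  apply/allrelP => x y; rewrite mem_nseq => /andP[_ /eqP ->].
  move=> /flattenP[_ /mapP[j js ->]]; rewrite mem_nseq => /andP[_ /eqP ->].
  exact: (allP ls).
elim: (c l) => //= n ->; rewrite andbT; apply/allP => j.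
by rewrite mem_nseq => /andP[_ /eqP ->].
Qed.

Lemma brick_row_labels_ok rs e0 es : row_labels_ok (brick_row rs e0 es).
Proof.
rewrite /row_labels_ok count_label0_brick_row labels_brick_row.
rewrite sorted_flatten_nseq.
  by case: (0 < e0)%N.
exact: iota_sorted.
Qed.

(** A row is determined by the length of its brick labeled 0 and by the
    number of bricks with each other label: the sequence of labels is
    sorted, hence determined by the numbers of occurrences, and a label
    determines the length of its bricks since label 0 occurs at most once. *)
Lemma brick_row_decode (rs : seq nat) (R : seq brick) :
  row_labels_ok R ->
  (forall b, b \in R -> b.1 = 0%N /\ (0 < b.2)%N \/
     exists2 i, (i < size rs)%N & b = (i.+1, nth 0%N rs i)) ->
  R = brick_row rs (\sum_(b <- R | b.1 == 0) b.2)%N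
        (mkseq (fun i => count (fun b : brick => b.1 == i.+1) R) (size rs)).
Proof.
move=> /andP[Rsorted R0] RP.
set e0 := (\sum_(b <- R | _) _)%N; set es := mkseq _ _.
(* It suffices to compare labels: both rows are recovered from them. *)
have len (S : seq brick) :
    (forall b, b \in S -> b.2 = nth 0%N (e0 :: rs) b.1) ->
    S = [seq (l, nth 0%N (e0 :: rs) l) | l <- [seq b.1 | b <- S]].
  move=> SP; rewrite -map_comp -[LHS]map_id.
  by apply/eq_in_map => -[l n] /SP /= ->.
have e0E b : b \in R -> b.1 = 0%N -> e0 = b.2.
  move=> bR b0; rewrite /e0; move: R0; rewrite count_sum_bool.
  rewrite (big_rem b) //= [in X in _ -> X = _](big_rem b) //= b0 eqxx.
  rewrite add1n ltnS leqn0 sum_nat_seq_eq0 => /allP h.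
  rewrite big_seq_cond big1 ?addn0 //.
  by move=> c /andP[cR c0]; have := h c cR; rewrite c0.
(* A brick labeled 0 has positive length, so e0 tells whether there is one. *)
have e0P : count (fun b : brick => b.1 == 0%N) R = (0 < e0)%N.
  have [/hasP[b bR /eqP b0]|] := boolP (has (fun b : brick => b.1 == 0%N) R).
    have -> : (0 < e0)%N.
      rewrite (e0E b) //; case: (RP b bR) => [[]|[i _ bi]] //.
      by move: b0; rewrite bi.
    apply/eqP; rewrite eqn_leq R0 -has_count; apply/hasP.
    by exists b => //; exact/eqP.
  move=> no0; have /hasPn no0P := no0.
  move: no0; rewrite has_count -leqNgt leqn0 => /eqP c0; rewrite c0 /e0.
  by rewrite big1_seq // => b /andP[b0 /no0P]; rewrite b0.
have lab : [seq b.1 | b <- R] = [seq b.1 | b <- brick_row rs e0 es].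
  apply: (sorted_eq leq_trans anti_leq) => //.
    by have /andP[] := brick_row_labels_ok rs e0 es.
  apply/allP => l _ /=; apply/eqP; rewrite !count_map.
  case: l => [|i].
    rewrite (@eq_count _ _ (fun b : brick => b.1 == 0%N)) //.
    by rewrite count_label0_brick_row -e0P.
  have [irs|irs] := ltnP i (size rs).
    rewrite -[RHS]/(count (fun b : brick => b.1 == i.+1) _).
    rewrite count_labelS_brick_row //.
    by rewrite nth_mkseq.
  transitivity 0%N; first apply/eqP; last apply/esym/eqP;
    rewrite -leqn0 leqNgt -has_count; apply/hasPn => b.
    move=> /RP h /=; case: h => [[-> _]|[j jrs ->]] //=; rewrite eqSS.
    by apply: contraTneq irs => <-; rewrite -ltnNge.
  move=> /flattenP[_ /mapP[l lrs ->]]; rewrite mem_nseq => /andP[_ /eqP ->] /=.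
  move: lrs; rewrite mem_iota /= add0n ltnS => lrs.
  by apply: contraTneq lrs => ->; rewrite -ltnNge ltnS.
rewrite [LHS]len => [|b bR].
  rewrite lab -len // => b /flattenP[_ /mapP[l _ ->]].
  by rewrite mem_nseq => /andP[_ /eqP ->].
by case: (RP b bR) => [[b0 _]|[i irs ->]] //; rewrite b0 /=; apply/esym/e0E.
Qed.

(** * Tabloids and factorizations *)

Lemma geq_trans : transitive geq.
Proof. by move=> y x z /= yx zy; exact: leq_trans yx. Qed.

Lemma geq_anti : antisymmetric geq.
Proof. by move=> x y /=; rewrite andbC; exact: anti_leq. Qed.

Lemma geq_total : total geq.
Proof. by move=> x y /=; exact: leq_total. Qed.

(** The partition lambda^(i) that records how the degree of p_i splits: one
    part k for each unit of exponent of a variable of degree k. *)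
Definition degree_part (n : monomial) : seq nat :=
  sort geq (flatten [seq nseq (n v) (val v.1) | v : var <- finsupp n]).

Lemma count_degree_part (n : monomial) (k : nat) :
  count_mem k (degree_part n) = (\sum_(v <- finsupp n | val v.1 == k) n v)%N.
Proof.
rewrite (permP (permEl (perm_sort _ _))) count_sum_bool big_flatten_nseq.
rewrite [RHS]big_mkcond; apply: eq_bigr => v _ /=.
by case: eqP; rewrite ?muln1 ?muln0.
Qed.

Lemma degree_part_of (n : monomial) : is_intpart_of (mwdeg n) (degree_part n).
Proof.
rewrite /is_intpart_of /is_intpart (sort_sorted geq_total) /= mem_sort.
apply/andP; split.
  apply/negP => /flattenP[_ /mapP[v _ ->]].
  rewrite mem_nseq => /andP[_ /eqP v0].
  by have := valP v.1; rewrite /= -v0.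
rewrite /mwdeg sumnE (perm_big _ (permEl (perm_sort _ _))) /=.
by rewrite big_flatten_nseq; apply/eqP; apply: eq_bigr => v _; rewrite mulnC.
Qed.

(** The variables of degree k in m, in the order of decreasing exponents,
    which is the order of the rows in the k-th component of the diagram of
    the type of m. *)
Definition degree_vars (m : monomial) (k : nat) : seq var :=
  sort (relpre m geq) [seq v : var <- finsupp m | val v.1 == k].

Lemma mem_degree_vars (m : monomial) k v :
  (v \in degree_vars m k) = (m v != 0%N) && (val v.1 == k).
Proof. by rewrite mem_sort mem_filter cmE_neq0 andbC. Qed.

Lemma degree_vars_uniq m k : uniq (degree_vars m k).
Proof. by rewrite sort_uniq filter_uniq ?fset_uniq. Qed.

Lemma map_degree_vars (m : monomial) k :
  [seq m v | v <- degree_vars m k] = restrict (mon_type m) k.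
Proof.
rewrite /degree_vars -sort_map; apply: (sorted_eq geq_trans geq_anti).
- exact: sort_sorted geq_total _.
- by have /andP[] := restrict_intpart (mon_type m) k.
- by rewrite perm_sort perm_sym restrict_mon_type.
Qed.

Lemma sum_degree_vars (m n : monomial) k (F : var -> nat) :
  (forall v, m v = 0%N -> F v = 0%N) -> (forall v, n v = 0%N -> F v = 0%N) ->
  (\sum_(v <- degree_vars m k) F v =
   \sum_(v <- finsupp n | val v.1 == k) F v)%N.
Proof.
move=> m0 n0; rewrite (perm_big _ (permEl (perm_sort _ _))) big_filter /=.
exact: big_finsupp_widen.
Qed.

Lemma count_bricks (sigma : btype) (delta : seq block) lam k (a : pred brick) :
  count a (@bricks sigma delta lam k) =
  (count (fun l => a (0%N, l)) (restrict sigma k) +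
   \sum_(i < size delta)
      count_mem k (lam i) * a (i.+1, nth 0 (map bmult delta) i))%N.
Proof.
rewrite /bricks count_cat count_map; congr (_ + _)%N.
rewrite count_sum_bool big_flatten_nseq big_enum /=; apply: eq_bigr => i _.
rewrite (nth_map (tnth (in_tuple delta) i)) //; congr (_ * a (_, bmult _))%N.
exact: tnth_nth.
Qed.

(** The bricks labeled 0 give back the type sigma and those labeled i give
    back the multiplicities of the parts of lambda^(i). *)
Lemma bricks_content (sigma sigma' : btype) (delta : seq block) lam lam' :
  (forall k,
     perm_eq (@bricks sigma delta lam k) (@bricks sigma' delta lam' k)) ->
  sigma = sigma' /\ forall i, perm_eq (lam i) (lam' i).
Proof.
move=> same; split.
  apply: btype_restrictP => k; apply/permP => c.
  have := permP (same k) (fun b => (b.1 == 0%N) && c b.2).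
  by rewrite !count_bricks /= !big1 ?addn0 // => i _; rewrite muln0.
move=> i; apply/allP => k _ /=; apply/eqP.
have := permP (same k) (fun b => b.1 == i.+1).
have none s : count (fun l : nat => (0%N, l).1 == i.+1) s = 0%N by elim: s.
have only_i (l : 'I_(size delta) -> seq nat) :
    (\sum_(j < size delta) count_mem k (l j) * (j.+1 == i.+1) =
     count_mem k (l i))%N.
  rewrite (bigD1 i) //= eqxx muln1 big1 ?addn0 // => j.
  by rewrite -val_eqE eqSS => /negbTE ->; rewrite muln0.
by rewrite !count_bricks !none !add0n /= !only_i.
Qed.

(** The tabloid that displays x = (n, (p_1, ..., p_s)): one row for each
    variable v of m, of length the exponent of v in n p_1^r_1 ... p_s^r_s. *)
Definition row_tabloid (delta : seq block) (m : monomial)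
    (x : monomial * seq monomial) : tabloid :=
  fun k => [seq brick_row (map bmult delta) (x.1 v)
                  [seq (p : monomial) v | p <- x.2] | v <- degree_vars m k].

(** A tabloid displays the exponents of n only at the variables of m, so it
    determines n only when this holds. *)
Definition supported_in (m n : monomial) : Prop :=
  forall v, m v = 0%N -> n v = 0%N.

Lemma nth_eval (ps : seq monomial) (v : var) i :
  nth 0%N [seq (p : monomial) v | p <- ps] i = nth mone ps i v.
Proof.
have [ips|ips] := ltnP i (size ps); first by rewrite (nth_map mone).
by rewrite !nth_default ?size_map // cm1.
Qed.

(** Whether or not the factors multiply to m, the bricks are those
    prescribed by the type of n and the partitions [degree_part] of the p_i.
    This is the dictionary between the content of a tabloid and the
    conditions on the factors. *)
Lemma row_tabloid_content (delta : seq block) m x k :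
  size x.2 = size delta -> supported_in m x.1 ->
  (forall i, supported_in m (nth mone x.2 i)) ->
  perm_eq (flatten (row_tabloid delta m x k))
    (@bricks (mon_type x.1) delta (fun i => degree_part (nth mone x.2 i)) k).
Proof.
move=> szx m1 m2; apply/permP => a.
rewrite count_bricks (permP (restrict_mon_type _ _)) count_mon_part.
rewrite count_sum_bool big_flatten big_map.
under eq_bigr => v _ do rewrite sum_brick_row size_map.
rewrite big_split /=; congr (_ + _)%N.
  rewrite (@sum_degree_vars m x.1) => [|v /m1 ->|v ->] //.
  rewrite [LHS]big_seq_cond [RHS]big_seq_cond; apply: eq_bigr => v /andP[].
  by rewrite -cmE_neq0 -lt0n => ->; rewrite mul1n.
rewrite exchange_big /=; apply: eq_bigr => i _.
under eq_bigr => v _ do rewrite nth_eval.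
rewrite -big_distrl /= count_degree_part; congr (_ * _)%N.
by apply: sum_degree_vars => // v; exact: m2.
Qed.

Lemma mwdeg_intpart (n : monomial) (d : nat) (l : seq nat) :
  perm_eq (degree_part n) l -> is_intpart_of d l -> mwdeg n = d.
Proof.
have /andP[_ /eqP <-] := degree_part_of n.
by move=> /perm_sumn -> /andP[_ /eqP].
Qed.

Definition factorizations (sigma : btype) (delta : seq block) (m : monomial) :
    set (monomial * seq monomial) :=
  ([set n | mon_type n = sigma] `*` mons_of_degrees (map bdeg delta)) `&`
  (fun x => mmul x.1 (pow_prod (map bmult delta) x.2)) @^-1` [set m].

Lemma size_mons_of_degrees ds ps : mons_of_degrees ds ps -> size ps = size ds.
Proof. by move=> <-; rewrite size_map. Qed.

Lemma nth_bmult_gt0 (delta : seq block) i :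
  (i < size delta)%N -> (0 < nth 0%N (map bmult delta) i)%N.
Proof.
case: delta => // b delta i_lt; rewrite (nth_map b) //.
exact: valP (nth b (b :: delta) i).2.
Qed.

Lemma factorization_exponentE delta (x : monomial * seq monomial) v :
  size x.2 = size delta ->
  mmul x.1 (pow_prod (map bmult delta) x.2) v =
  (x.1 v +
   \sum_(i < size delta) nth mone x.2 i v * nth 0 (map bmult delta) i)%N.
Proof.
move=> szx; rewrite cmM pow_prodE ?size_map //; congr (_ + _)%N.
by apply: eq_bigr => i _; rewrite mulnC.
Qed.

Lemma factorizations_supported sigma delta m x :
  factorizations sigma delta m x ->
  [/\ size x.2 = size delta, supported_in m x.1 &
      forall i, supported_in m (nth mone x.2 i)].
Proof.
move=> [[_ /size_mons_of_degrees xd]]; rewrite size_map in xd => /= xm.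
split=> // [v|i v]; rewrite -xm factorization_exponentE //;
  move=> /eqP; rewrite addn_eq0.
  by move=> /andP[/eqP].
move=> /andP[_]; rewrite sum_nat_eq0 => /forallP xi.
have [id|id] := ltnP i (size delta); last by rewrite nth_default ?xd // cm1.
have := xi (Ordinal id); rewrite /= muln_eq0 => /orP[/eqP //|].
by rewrite eqn0Ngt nth_bmult_gt0.
Qed.

(** Row lengths match the shape exactly when the factors multiply to m, and
    by [bricks_content] the content is (sigma; delta) exactly when n has
    type sigma and each p_i has degree d_i. *)
Lemma row_tabloid_HTBTP sigma delta m x :
  size x.2 = size delta -> supported_in m x.1 ->
  (forall i, supported_in m (nth mone x.2 i)) ->
  HTBT (mon_type m) sigma delta (row_tabloid delta m x) <->
  factorizations sigma delta m x.
Proof.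
move=> szx m1 m2; have content k := row_tabloid_content k szx m1 m2.
have rowlen v : row_length (brick_row (map bmult delta) (x.1 v)
    [seq (p : monomial) v | p <- x.2]) =
    mmul x.1 (pow_prod (map bmult delta) x.2) v.
  rewrite row_length_brick_row factorization_exponentE // size_map.
  congr (_ + _)%N.
  by apply: eq_bigr => i _; rewrite nth_eval.
split=> [[shape [_ [lam [lamd lamP]]]]|[[xs xd] /= xm]].
  have [xs xl] : mon_type x.1 = sigma /\
      forall i : 'I_(size delta),
        perm_eq (degree_part (nth mone x.2 i)) (lam i).
    apply: bricks_content => k; apply: perm_trans (lamP k).
    by rewrite perm_sym; exact: content.
  split; first split=> //=.
    rewrite /mons_of_degrees /=; apply: (@eq_from_nth _ 0%N).
      by rewrite !size_map.
    rewrite size_map => i ix; rewrite (nth_map mone) //; rewrite szx in ix.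
    rewrite (mwdeg_intpart (xl (Ordinal ix)) (lamd (Ordinal ix))).
    rewrite (nth_map (tnth (in_tuple delta) (Ordinal ix))) //.
    by rewrite [in LHS](tnth_nth (tnth (in_tuple delta) (Ordinal ix))).
  apply/eqP/cmP => v; have [mv|mv] := eqVneq (m v) 0%N.
    rewrite factorization_exponentE // m1 // mv big1 // => i _.
    by rewrite m2.
  have := shape (val v.1); rewrite -map_degree_vars -map_comp => /eq_in_map sh.
  by rewrite -rowlen; apply: sh; rewrite mem_degree_vars mv eqxx.
split=> [k|].
  rewrite -map_degree_vars -map_comp; apply: eq_map => v /=.
  by rewrite rowlen xm.
split=> [k|].
  by apply/allP => R /mapP[v _ ->]; exact: brick_row_labels_ok.
exists (fun i => degree_part (nth mone x.2 i)); split=> [i|k].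
  have -> : bdeg (tnth (in_tuple delta) i) = mwdeg (nth mone x.2 i).
    rewrite -[RHS](nth_map _ 0%N) ?szx // xd.
    rewrite (nth_map (tnth (in_tuple delta) i)) //.
    by rewrite [in LHS](tnth_nth (tnth (in_tuple delta) i)).
  exact: degree_part_of.
by rewrite -xs; exact: content.
Qed.

(** Injectivity and surjectivity both come from reading the exponents back
    from the rows: the row of v is found at the position of v in
    [degree_vars]. *)
Lemma row_tabloid_bij sigma delta m :
  set_bij (factorizations sigma delta m) (HTBT (mon_type m) sigma delta)
    (row_tabloid delta m).
Proof.
split.
- move=> x xf; have [szx m1 m2] := factorizations_supported xf.
  exact/row_tabloid_HTBTP.
- move=> x y /set_mem/factorizations_supported[szx mx1 mx2].
  move=> /set_mem/factorizations_supported[szy my1 my2] xy.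
  have row v : m v != 0%N ->
      brick_row (map bmult delta) (x.1 v) [seq (p : monomial) v | p <- x.2] =
      brick_row (map bmult delta) (y.1 v) [seq (p : monomial) v | p <- y.2].
    move=> mv; have /eq_in_map := congr1 (fun T => T (val v.1)) xy.
    by apply; rewrite mem_degree_vars mv eqxx.
  have e1 : x.1 = y.1.
    apply/eqP/cmP => v; have [mv|/row rv] := eqVneq (m v) 0%N.
      by rewrite mx1 // my1.
    by have := congr1 (fun S : seq brick => \sum_(b <- S | b.1 == 0) b.2)%N rv;
      rewrite !sum_label0_brick_row.
  have e2 : x.2 = y.2.
    apply: (@eq_from_nth _ mone); first by rewrite szx.
    move=> i ix; apply/eqP/cmP => v; have [mv|/row rv] := eqVneq (m v) 0%N.
      by rewrite mx2 // my2.
    have := congr1 (count (fun b : brick => b.1 == i.+1)) rv.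
    by rewrite !count_labelS_brick_row ?size_map -?szx // !nth_eval.
  by case: x y e1 e2 {szx mx1 mx2 szy my1 my2 xy row} => [? ?] [? ?] /= -> ->.
move=> T TP; have [shape [labels [lam [lamd lamP]]]] := TP.
(* R v is the row of v in T, and the empty row if v does not occur in m. *)
pose R v : seq brick :=
  nth [::] (T (val v.1)) (index v (degree_vars m (val v.1))).
have szT k : size (T k) = size (degree_vars m k).
  by rewrite -(size_map row_length) shape -map_degree_vars size_map.
have TR k : T k = [seq R v | v <- degree_vars m k].
  apply: (@eq_from_nth _ [::]); first by rewrite size_map szT.
  move=> j jT; rewrite szT in jT.
  pose v0 : var := (posone, posone).
  rewrite (nth_map v0) // /R; have := mem_nth v0 jT.
  rewrite mem_degree_vars => /andP[_ /eqP ->].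
  by rewrite index_uniq // degree_vars_uniq.
pose n0 : monomial := mkcmonom [fsfun v in finsupp m =>
  (\sum_(b <- R v | b.1 == 0) b.2)%N | 0%N].
pose p (i : nat) : monomial := mkcmonom [fsfun v in finsupp m =>
  count (fun b : brick => b.1 == i.+1) (R v) | 0%N].
pose x := (n0, mkseq p (size delta)).
have szx : size x.2 = size delta by rewrite size_mkseq.
have m1 : supported_in m x.1.
  by move=> v /eqP; rewrite cmE_eq0 cmE fsfun_fun => /negbTE ->.
have m2 i : supported_in m (nth mone x.2 i).
  move=> v mv; have [id|id] := ltnP i (size delta); last first.
    by rewrite nth_default ?szx // cm1.
  rewrite nth_mkseq //; move: mv => /eqP; rewrite cmE_eq0 cmE fsfun_fun.
  by move=> /negbTE ->.
have xT : row_tabloid delta m x = T.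
  apply/funext => k; rewrite TR; apply/eq_in_map => v vk.
  have vm : v \in finsupp m.
    by move: vk; rewrite mem_degree_vars -cmE_neq0 => /andP[].
  have RT : R v \in T k by rewrite TR map_f.
  rewrite [RHS](@brick_row_decode (map bmult delta)).
  - congr brick_row; first by rewrite cmE fsfun_fun vm.
    rewrite -map_comp size_map; apply: eq_map => i /=.
    by rewrite cmE fsfun_fun vm.
  - exact: (allP (labels k)).
  move=> b bR; have : b \in bricks sigma lam k.
    by rewrite -(perm_mem (lamP k)); apply/flattenP; exists (R v).
  rewrite mem_cat => /orP[/mapP[l ls ->]|].
    left; split=> //=; rewrite lt0n; apply: contraTneq ls => ->.
    by have /andP[] := restrict_intpart sigma k.
  move=> /flattenP[_ /mapP[i _ ->]]; rewrite mem_nseq => /andP[_ /eqP ->].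
  right; exists i; first by rewrite size_map.
  rewrite (nth_map (tnth (in_tuple delta) i)) //; congr (_, bmult _).
  exact: tnth_nth.
by exists x => //; apply/row_tabloid_HTBTP => //; rewrite xT.
Qed.

(** * Coefficients on the tensor monomial basis *)

Definition btype_weight (t : btype) : nat :=
  (\sum_(b <- val t) bdeg b * bmult b)%N.

Lemma mwdeg_mon_type (m : monomial) : mwdeg m = btype_weight (mon_type m).
Proof.
rewrite /btype_weight (perm_big _ (permEl (perm_sort _ _))) big_map.
by apply: eq_big_seq => v vm; rewrite bmult_var_block.
Qed.

Lemma mwdegM (m n : monomial) : mwdeg (mmul m n) = (mwdeg m + mwdeg n)%N.
Proof.
rewrite /mwdeg; under eq_bigr => v _ do rewrite cmM mulnDr.
rewrite big_split /=; congr (_ + _)%N; apply: big_finsupp_widen => v;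
  rewrite ?cmM; move=> /eqP; rewrite ?addn_eq0.
- by move=> /andP[/eqP ->]; rewrite muln0.
- by move=> /eqP ->; rewrite muln0.
- by move=> /andP[_ /eqP ->]; rewrite muln0.
- by move=> /eqP ->; rewrite muln0.
Qed.

Lemma mwdeg_pow_mon (r : nat) (n : monomial) :
  mwdeg (pow_mon r n) = (r * mwdeg n)%N.
Proof.
rewrite /mwdeg big_distrr /=; under eq_bigr => v _ do rewrite pow_monE.
rewrite (@big_finsupp_widen _ _ _ _ n) => [|v|v ->]; rewrite ?muln0 //.
  by apply: eq_bigr => v _; rewrite mulnCA.
by rewrite pow_monE => ->; rewrite muln0.
Qed.

Lemma mwdeg_pow_prod (rs : seq nat) (ps : seq monomial) :
  mwdeg (pow_prod rs ps) = (\sum_(x <- zip rs (map mwdeg ps)) x.1 * x.2)%N.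
Proof.
rewrite /pow_prod; elim: rs ps => [|r rs IHrs] [|p ps];
  rewrite ?big_nil /mwdeg ?mdom1 ?big_seq_fset0 //= -/(mwdeg _).
by rewrite !big_cons mwdegM mwdeg_pow_mon IHrs.
Qed.

(** The degree bounds the number of blocks as well as their degrees and
    multiplicities, which are positive. *)
Lemma finite_btype_weight (D : nat) :
  finite_set [set t : btype | btype_weight t = D].
Proof.
pose A := [set b : block | (bdeg b < D.+1)%N /\ (bmult b < D.+1)%N].
have finA : finite_set A.
  apply: (@finite_preimage _ _ (`I_D.+1 `*` `I_D.+1)
    (fun b => (bdeg b, bmult b))).
    move=> [d e] [d' e'] _ _ []; rewrite /bdeg /bmult /= => dd ee.
    by congr (_, _); exact: val_inj.
  by apply: finite_setX; exact: finite_II.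
apply: (@sub_finite_set _ _ (val @^-1` [set s : seq block |
    (size s <= D)%N /\ forall b, b \in s -> A b])); last first.
  apply: finite_preimage; first by move=> t u _ _; exact: val_inj.
  exact: finite_bounded_seqs.
have pos b : (0 < bdeg b)%N /\ (0 < bmult b)%N.
  by split; [exact: (valP b.1)|exact: (valP b.2)].
move=> t /= tD; split=> [|b bt].
  rewrite -tD -sum1_size; apply: leq_sum => b _.
  by have [d0 m0] := pos b; rewrite muln_gt0 d0.
have [d0 m0] := pos b; rewrite /A /= !ltnS -tD /btype_weight (big_rem b) //=.
by split; apply: leq_trans (leq_addr _ _); [exact: leq_pmulr|exact: leq_pmull].
Qed.

(** The block d^e at position i, counted from 0, becomes x_{d,i+1} ^ e.
    Using the position in the whole type as second index makes these
    variables distinct; [.-1] goes back from the index, which starts at 1,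
    to the position. *)
Definition mon_of_type (t : btype) : monomial :=
  mkcmonom [fsfun v in
    [fset v : var in [seq ((nth (posone, posone) (val t) i).1,
                       exist _ i.+1 isT : posnat)
                | i <- iota 0 (size (val t))]]%fset =>
    bmult (nth (posone, posone) (val t) (val v.2).-1) | 0%N].

Lemma mon_of_typeK (t : btype) : mon_type (mon_of_type t) = t.
Proof.
set b := nth (posone, posone) (val t).
pose x i : var := ((b i).1, exist _ i.+1 isT : posnat).
have mE v : mon_of_type t v =
    if v \in [seq x i | i <- iota 0 (size (val t))] then
      bmult (b (val v.2).-1) else 0%N.
  by rewrite cmE fsfun_fun !inE.
have supp : perm_eq (finsupp (mon_of_type t))
                    [seq x i | i <- iota 0 (size (val t))].
  apply: uniq_perm; first exact: fset_uniq.
    by rewrite map_inj_uniq ?iota_uniq // => i j [].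
  move=> v; rewrite -cmE_neq0 mE; case: ifP => // _.
  by rewrite -lt0n; exact: (valP (b (val v.2).-1).2).
apply: val_inj => /=.
apply: (sorted_eq block_ge_trans block_ge_anti) (valP t) _.
  exact: sort_sorted block_ge_total _.
rewrite perm_sort; apply: perm_trans (perm_map _ supp) _.
rewrite -map_comp -[X in perm_eq _ X](mkseq_nth (posone, posone)) /mkseq.
have /eq_in_map -> // : {in iota 0 (size (val t)),
    var_block (mon_of_type t) \o x =1 b}.
move=> i it.
have xi : x i \in [seq x j | j <- iota 0 (size (val t))] by rewrite map_f.
by rewrite /= /var_block mE xi /= /bmult valKd -/b; case: (b i).
Qed.

(** The variables of m' are those of m transported by an injective map that
    keeps degrees. *)
Lemma mon_type_permuted (k : posnat) (s : posnat -> posnat) (m m' : monomial) :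
  bijective s -> (forall j, m' (k, s j) = m (k, j)) ->
  (forall i j, i != k -> m' (i, j) = m (i, j)) -> mon_type m' = mon_type m.
Proof.
move=> [s' ss' s's] m'k m'i.
(* h s is the action on variables of the permutation s of the x_{k,j}. *)
pose h (u : posnat -> posnat) (v : var) : var :=
  if v.1 == k then (k, u v.2) else v.
have hK u u' : cancel u u' -> cancel (h u) (h u').
  move=> uu' [i j]; rewrite /h /=; case: (eqVneq i k) => [->|ik] /=.
    by rewrite eqxx uu'.
  by rewrite (negbTE ik).
have m'h v : m' (h s v) = m v.
  case: v => i j; rewrite /h /=; case: (eqVneq i k) => [->|ik].
    exact: m'k.
  exact: m'i.
have supp : perm_eq (finsupp m') [seq h s v | v <- finsupp m].
  apply: uniq_perm; first exact: fset_uniq.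
    by rewrite map_inj_uniq ?fset_uniq //; exact: can_inj (hK _ _ ss').
  move=> v; rewrite -[v](hK s' s s's) mem_map; last exact: can_inj (hK _ _ ss').
  by rewrite -!cmE_neq0 m'h.
apply/mon_typeP => d.
apply: perm_trans (_ : perm_eq _ (mon_part m d)) _; last first.
  by rewrite perm_sym restrict_mon_type.
apply/permP => a; rewrite !count_mon_part (perm_big _ supp) big_map /=.
apply: eq_big => [[i j]|v _]; last by rewrite m'h.
by rewrite /h /=; have [->|] := eqVneq i k.
Qed.

(** By [mtensorE] the expansion with coefficients c has c (mon_type m) as
    coefficient at m. Hence a homogeneous series depending only on the type
    has exactly one expansion, whose coefficients are read on the monomials
    [mon_of_type]; it is finite because only types of degree D occur. *)
Lemma mtensor_coef_of_type (f : series) (g : btype -> rat) (D : nat)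
    (t : btype) :
  (forall m, f m = g (mon_type m)) -> (forall m, f m != 0 -> mwdeg m = D) ->
  is_mtensor_coef t f (g t).
Proof.
move=> fg fD; split; first split.
- exists D => m Dm; apply/eqP; apply: contraTT Dm => /fD ->.
  by rewrite ltnn.
- move=> k s bs m m' h1 h2; rewrite !fg.
  by rewrite (@mon_type_permuted k s m m').
(* Every type is the type of a monomial, so g inherits homogeneity from f. *)
have gD u : g u != 0 -> btype_weight u = D.
  by rewrite -[u]mon_of_typeK -fg -mwdeg_mon_type; exact: fD.
pose S := fset_set [set u : btype | btype_weight u = D].
pose c : {fsfun btype -> rat with 0} := [fsfun u in S => g u | 0].
have cE u : c u = g u.
  rewrite fsfun_fun in_fset_set; last exact: finite_btype_weight.
  case: ifPn => // /negP uD; apply/eqP; rewrite eq_sym.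
  by apply/negP => /negP /gD uD'; apply: uD; rewrite inE.
have expand (c' : {fsfun btype -> rat with 0}) m :
    \sum_(u <- finsupp c') c' u * mtensor u m = c' (mon_type m).
  under eq_bigr => u _ do rewrite mtensorE.
  have [mc|mc] := finsuppP c' (mon_type m).
    rewrite big1_seq // => u /andP[_ uc].
    by case: eqP => [mu|_]; rewrite ?mulr0 //; move: mc; rewrite mu uc.
  rewrite (big_fsetD1 (mon_type m)) //= eqxx mulr1 big1_seq ?addr0 // => u.
  by move=> /andP[_]; rewrite !inE => /andP[/negbTE um _];
    rewrite eq_sym um mulr0.
exists c; split=> [m|c' fc'|//]; first by rewrite expand cE.
apply/fsfunP => u; rewrite -[u]mon_of_typeK.
by rewrite -expand -fc' fg cE.
Qed.

Lemma finite_fixed_mon_type (sigma : btype) :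
  finite_fibres [set n : monomial | mon_type n = sigma] id.
Proof. exact: inj_finite_fibres. Qed.

Lemma finite_factorizations_of_type (sigma : btype) (delta : seq block)
    (m : monomial) : finite_set (factorizations sigma delta m).
Proof.
exact: (finite_fibres_mul (@finite_fixed_mon_type sigma)
  (Hblocks_gen_series delta).1).
Qed.

Lemma mtensor_mul_HblocksE (sigma : btype) (delta : seq block)
    (m : monomial) :
  series_mul (mtensor sigma) (Hblocks delta) m =
  (#|` fset_set (factorizations sigma delta m)|)%fset%:R.
Proof.
have [finH ->] := Hblocks_gen_series delta.
have fin1 := @finite_fixed_mon_type sigma.
rewrite mtensor_gen_series gen_series_mul // gen_series_card //.
exact: (finite_fibres_mul fin1 finH).
Qed.

Lemma card_fset_set_bij (T U : choiceType) (A : set T) (B : set U)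
    (h : T -> U) :
  finite_set A -> set_bij A B h -> #|` fset_set A|%fset = #|` fset_set B|%fset.
Proof.
move=> finA [AB hinj hsurj].
have -> : B = h @` A.
  by apply/seteqP; split=> [y /hsurj|_ [x /AB ? <-]].
rewrite fset_set_image // card_in_imfset //= => x y.
by rewrite !in_fset_set //; exact: hinj.
Qed.

Theorem theorem62 (tau sigma : btype) (delta : seq block) :
  is_mtensor_coef tau (series_mul (mtensor sigma) (Hblocks delta))
    (#|` fset_set (HTBT tau sigma delta)|%fset)%:R.
Proof.
have fin := finite_factorizations_of_type sigma delta.
apply: (@mtensor_coef_of_type _
  (fun t => (#|` fset_set (HTBT t sigma delta)|%fset)%:R)
  (* the degree of every monomial of the product *)
  (btype_weight sigma +
   \sum_(x <- zip (map bmult delta) (map bdeg delta)) x.1 * x.2)%N) => m;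
  rewrite mtensor_mul_HblocksE.
  by rewrite (card_fset_set_bij (fin m) (@row_tabloid_bij sigma delta m)).
rewrite pnatr_eq0 cardfs_eq0 => /fset0Pn[[n ps]]; rewrite in_fset_set // inE.
move=> [[/= nsigma psd] <-]; rewrite mwdegM mwdeg_pow_prod psd.
by rewrite mwdeg_mon_type nsigma.
Qed.
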